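(* Assume that the Boolean algebra $\mathcal{P}(\mathbb{N})$ is $(\aleph_1,\aleph_0)$-ideal and that $2^{\aleph_1}=\mathfrak{c}$, where $\mathfrak{c}=2^{\aleph_0}$. Let $\mathbb{D}$ be the Alexandroff double of the Cantor set and let $\mathbb{K}=\mathbb{D}\times\mathbb{D}$. Then $\mathbb{K}$ has a compact subspace $X$ that is not a continuous image of $\mathbb{N}^*=\beta\mathbb{N}\setminus\mathbb{N}$.
   Context: Let $\mathbb{C}$ be the Cantor set. The Alexandroff double $\mathbb{D}$ is the set $\mathbb{C}\times 2$ (with $2=\{0,1\}$) topologized as follows: all points of $\mathbb{C}\times\{1\}$ are isolated, and the basic neighbourhoods of a point $\langle x,0\rangle$ are the sets $(U\times 2)\setminus\{\langle x,1\rangle\}$, where $U$ is a neighbourhood of $x$ in $\mathbb{C}$. A subalgebra $A$ of a Boolean algebra $B$ is \emph{$\aleph_0$-ideal} if for each $b\in B\setminus A$ the ideal $\{a\in A: a<b\}$ of $A$ has a countable cofinal subset. A Boolean algebra $B$ is \emph{$(\aleph_1,\aleph_0)$-ideal} if there is a family $\mathcal{A}$ of $\aleph_0$-ideal subalgebras of $B$, each of cardinality $\aleph_1$, such that every subset of $B$ of size $\aleph_1$ is contained in some member of $\mathcal{A}$ and the union of each chain from $\mathcal{A}$ of cofinality $\omega_1$ is again in $\mathcal{A}$. *)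

(* Defs.v *)
From HB Require Import structures.
From mathcomp Require Import all_boot all_order.
From mathcomp Require Import all_classical all_analysis.

Set Implicit Arguments.
Unset Strict Implicit.
Unset Printing Implicit Defensive.

Import Order.TTheory.
Local Open Scope classical_set_scope.
Local Open Scope card_scope.

(* aleph_1 is the least uncountable cardinal. *)
Definition card_aleph1 {T : Type} (A : set T) : Prop :=
  ~ countable A /\ forall (U : Type) (B : set U), ~ countable B -> A #<= B.

(* The continuum is the cardinality of [set: set nat]. *)
Definition two_pow_aleph1_eq_continuum : Prop :=
  forall (T : Type) (A : set T), card_aleph1 A ->
    [set B : set T | B `<=` A] #= [set: set nat].

(* The cofinality of a linearly ordered set is the least cardinality of a
   cofinal subset; here the order is inclusion on a chain of sets. *)
Definition chain_cofinal {T : Type} (C D : set (set T)) : Prop :=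
  D `<=` C /\ forall A, C A -> exists2 A', D A' & A `<=` A'.

Definition chain_of_cofinality_omega1 {T : Type} (C : set (set T)) : Prop :=
  [/\ total_on C subset,
      exists2 D, chain_cofinal C D & card_aleph1 D &
      forall D, chain_cofinal C D -> ~ countable D].

Section boolean_algebras.
Context {d : Order.disp_t} {B : ctbDistrLatticeType d}.
Local Open Scope order_scope.

Definition subalgebra (A : set B) : Prop :=
  [/\ A \bot, A \top,
      forall x y, A x -> A y -> A (x `&` y),
      forall x y, A x -> A y -> A (x `|` y) &
      forall x, A x -> A (~` x)].

Definition aleph0_ideal_subalgebra (A : set B) : Prop :=
  subalgebra A /\
  forall b : B, ~ A b ->
    exists C : set B,
      [/\ countable C, (C `<=` [set a | A a /\ a < b])%classic &
          forall a, A a -> a < b -> exists2 c, C c & a <= c].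

End boolean_algebras.

Definition aleph1_aleph0_ideal {d : Order.disp_t} (B : ctbDistrLatticeType d) :
    Prop :=
  exists F : set (set B),
    [/\ forall A, F A -> aleph0_ideal_subalgebra A /\ card_aleph1 A,
        forall S : set B, card_aleph1 S -> exists2 A, F A & S `<=` A &
        forall C : set (set B), C `<=` F -> chain_of_cofinality_omega1 C ->
          F (\bigcup_(A in C) A)].

(** [true] marks the isolated copy of the Cantor set. *)

Definition alexandroff_double : Type := (cantor_space * bool)%type.

HB.instance Definition _ :=
  Choice.copy alexandroff_double (cantor_space * bool)%type.

Definition alexandroff_nbhs (p : alexandroff_double) :
    set_system alexandroff_double :=
  if p.2 then principal_filter p
  else filter_from (nbhs p.1)
         (fun U => (U `*` [set: bool]) `\ (p.1, true)).

HB.instance Definition _ := hasNbhs.Build alexandroff_double alexandroff_nbhs.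

Lemma alexandroff_nbhs_filter (p : alexandroff_double) : ProperFilter (nbhs p).
Proof.
rewrite /nbhs /= /alexandroff_nbhs; case: p => x [] /=.
  exact: principal_filter_proper.
apply: filter_from_proper.
  apply: filter_from_filter; first by exists setT; exact: filterT.
  move=> U V xU xV; exists (U `&` V); first exact: filterI.
  by move=> q [[[Uq Vq] _] qx]; split; split.
move=> U xU; exists (x, false); split => //.
by split => //; exact: nbhs_singleton.
Qed.

Lemma alexandroff_nbhs_singleton (p : alexandroff_double)
  (A : set alexandroff_double) : nbhs p A -> A p.
Proof.
rewrite /nbhs /= /alexandroff_nbhs; case: p => x [] /=; first exact.
case=> U xU; apply; split => //.
by split => //; exact: nbhs_singleton.
Qed.

Lemma alexandroff_nbhs_nbhs (p : alexandroff_double)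
  (A : set alexandroff_double) : nbhs p A -> nbhs p (nbhs^~ A).
Proof.
rewrite /nbhs /= /alexandroff_nbhs; case: p => x [] /=.
  by move=> /principal_filterP Ax; apply/principal_filterP/principal_filterP.
case=> U xU UA; exists (interior U); first exact/nbhs_interior.
move=> [y []] [] [/= Uy _] yx.
  apply/principal_filterP/UA; split => //.
  by split => //; exact: nbhs_singleton.
have [->|/eqP ynx] := eqVneq y x; first by exists U.
exists (U `&` ~` [set x]).
  apply: filterI; first exact: Uy.
  apply: open_nbhs_nbhs; split => //; apply: closed_openC.
  exact/accessible_closed_set1/hausdorff_accessible/cantor_space_hausdorff.
move=> [z b] [[/= [Uz zx] _] _]; apply: UA; split => //.
by case=> /zx.
Qed.

HB.instance Definition _ := Nbhs_isNbhsTopological.Build alexandroff_double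
  alexandroff_nbhs_filter alexandroff_nbhs_singleton alexandroff_nbhs_nbhs.

(** The Stone-Cech compactification of the discrete space [nat], as the space
    of ultrafilters on [nat] with basic open sets [set u | u A], A a subset of
    [nat]; a point n of [nat] is identified with its principal ultrafilter. *)

Record betaN : Type := BetaN {
  sets_of :> set_system nat;
  betaN_ultra : UltraFilter sets_of }.

HB.instance Definition _ := gen_eqMixin betaN.
HB.instance Definition _ := gen_choiceMixin betaN.

Definition betaN_base (A : set nat) : set betaN := [set u | sets_of u A].

Lemma betaN_base_cover : \bigcup_(A in [set: set nat]) betaN_base A = setT.
Proof.
apply/seteqP; split => // u _; exists setT => //=.
by have ? := betaN_ultra u; exact: filterT.
Qed.

Lemma betaN_base_join (A B : set nat) (u : betaN) :
  [set: set nat] A -> [set: set nat] B -> betaN_base A u -> betaN_base B u ->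
  exists C, [/\ [set: set nat] C, betaN_base C u &
                betaN_base C `<=` betaN_base A `&` betaN_base B].
Proof.
move=> _ _ uA uB; exists (A `&` B); split => //.
  by have ? := betaN_ultra u; exact: filterI.
move=> v vAB; have ? := betaN_ultra v.
by split; apply: filterS vAB => // n [].
Qed.

HB.instance Definition _ :=
  isBaseTopological.Build betaN betaN_base_cover betaN_base_join.

Definition nat_to_betaN (n : nat) : betaN := BetaN (principal_filter_ultra n).

Definition Nstar : set betaN := ~` range nat_to_betaN.

(** [X], with the subspace topology, is a continuous image of the subspace
    [A]; only the values of [f] on [A] matter. *)
Definition continuous_image_of {S T : topologicalType} (A : set S) (X : set T) :
    Prop :=
  exists2 f : S -> T, {within A, continuous f} & f @` A = X.

(* Main.v *)
Require Import Defs.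
From mathcomp Require Import all_boot all_order.
From mathcomp Require Import all_classical all_analysis.
From mathcomp Require wochoice.

Local Open Scope classical_set_scope.

(** Write W for the ordinal omega_1 and D for the Alexandroff double of the
    Cantor set C.  For a relation E on C let X be the square of D with the
    isolated points ((x,1),(y,1)), not E x y, deleted ([pruned_square]); it is
    closed, hence compact.  The set of points whose first coordinate is (x,1)
    is clopen, and so is the set of points whose second coordinate is (y,1).
    A continuous map f from N* onto X pulls them back to clopen sets, and a
    clopen subset of N* is the trace of some subset of N ([Nstar_clopen]).
    Hence f yields sets a_x and b_y such that a_x meets b_y in an infinite set
    exactly when E x y.  The relation E is chosen so that this is impossible.

    Fix an injection l of W into C.  By [uncoded_set], for each W-sequence
    a of subsets of N there is a subset Z(a) of W that no b codes, i.e. such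
    that Z(a) is never {w | a_w meets b in a finite set}.  Since 2^aleph_1 is
    the continuum, C can enumerate all these sequences as s_y.  Let E (l w) y
    mean that w is not in Z(s_y).  If X were a continuous image of N*, then
    the sequence of the sets a_(l w) would be s_y for some y, and b_y would
    code Z(s_y).

    The set Z(a) comes from the ideal hypothesis.  Take an aleph_0-ideal
    subalgebra A of size aleph_1 containing all a_w and all initial segments
    of N.  The ideal of the members of A below the complement of b has a
    countable cofinal subset, so a set coded by b is a countable union of sets
    {w | a_w is almost contained in c} with c in A.  There are only aleph_1
    sets of this form, so a Bernstein construction ([bernstein]) gives an
    uncountable Z that includes no uncountable one of them; such a Z is not a
    countable union of them. *)

(** * The ordinal omega_1 *)

Definition omega1_order (W : Type) (lt : W -> W -> Prop) : Prop :=
  [/\ well_founded lt,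
      forall v w, [\/ lt v w, v = w | lt w v],
      forall w, countable [set v | lt v w] &
      ~ countable [set: W]].

Lemma uncountable_image (T U : Type) (g : T -> U) (A : set T) (B : set U) :
  set_inj A g -> g @` A `<=` B -> ~ countable A -> ~ countable B.
Proof.
move=> ginj gAB; apply: contra_not => cB.
apply: sub_countable (sub_countable (subset_card_le gAB) cB).
by have /card_eqPle[] := inj_card_eq ginj.
Qed.

Lemma uncountable_set_nat : ~ countable [set: set nat].
Proof.
move=> /pcard_surjP[g gsurj].
have [n _ gn] := gsurj [set k | ~ g k k] I.
have gnn : g n n = (~ g n n) by rewrite {1}gn.
have ngnn : ~ g n n by move=> h; move: (h); rewrite gnn.
by apply: (ngnn); rewrite gnn.
Qed.

(** In a well-ordering of the power set of N, the points with countably many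
    predecessors form an initial segment.  It is uncountable, because otherwise
    the least point outside it would have countably many predecessors. *)
Lemma omega1_exists : exists (W : Type) (lt : W -> W -> Prop), omega1_order W lt.
Proof.
have [R Rwo] := wochoice.well_ordering_principle (set nat).
pose lt x y := R x y /\ x <> y.
have Rmin (A : set (set nat)) : A !=set0 ->
    exists2 m, A m & forall x, A x -> R m x.
  move=> [x Ax]; have [|m [[mA lem] _]] := Rwo (mem A).
    by exists x; rewrite inE.
  by exists m => [|y Ay]; [rewrite inE in mA | apply: lem; rewrite inE].
have Rtot x y : R x y \/ R y x.
  have [|m [->|->] Rm] := Rmin [set x; y]; first by exists x; left.
    by left; apply: Rm; right.
  by right; apply: Rm; left.
have Ranti x y : R x y -> R y x -> x = y.
  move=> xy yx; have [|m [_ um]] := Rwo (mem [set x; y]).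
    by exists x; rewrite inE; left.
  have Rxx z : R z z by have [] := Rtot z z.
  rewrite -(um x) ?(um y) //; (split; first by rewrite inE; (left + right)).
    by move=> z; rewrite inE => -[] ->.
  by move=> z; rewrite inE => -[] ->.
have ltwf : well_founded lt.
  move=> x; apply: contrapT => nx; have [|m nm mmin] := Rmin [set x | ~ Acc lt x].
    by exists x.
  apply: nm; constructor => y [Rym ym]; apply: contrapT => ny.
  by apply: ym; apply: Ranti => //; exact: mmin.
pose D := [set v | countable [set u | lt u v]].
exists (set_type D), (fun u v => lt (\val u) (\val v)); split.
- move=> u; move vu: (\val u) => x; elim: (ltwf x) u vu => {}x _ IH u vu.
  by constructor => v; rewrite vu => vx; exact: IH vx _ erefl.
- move=> u v; have [->|uv] := eqVneq u v; first exact: Or32.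
  have {}uv : \val u <> \val v by move=> /val_inj; exact/eqP.
  by have [R1|R1] := Rtot (\val u) (\val v); [apply: Or31|apply: Or33];
    split => // /esym.
- move=> [v vD] /=; move: (vD); rewrite inE => cv.
  apply: contrapT => unc.
  apply: (@uncountable_image _ _ (@set_val _ D) _ [set u | lt u v] _ _ unc cv).
    by move=> a b _ _; exact: val_inj.
  by move=> _ [a ? <-].
- suff Dunc : ~ countable D.
    apply: contra_not Dunc => cD.
    have -> : D = @set_val _ D @` setT.
      apply/seteqP; split=> [x Dx|_ [[x xD] _ <-]].
        by have xD := mem_set Dx; exists (SigSub xD).
      exact: set_mem xD.
    by apply: sub_countable cD; exact: card_image_le.
  move=> cD; have [|m nDm mmin] := Rmin (~` D).
    apply: contra_notP uncountable_set_nat => nex.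
    suff <- : D = setT by [].
    by apply/seteqP; split=> // v _; apply: contrapT => nDv; apply: nex; exists v.
  apply: nDm; apply: sub_countable cD; apply: subset_card_le => u [um ne].
  by apply: contrapT => nDu; apply: ne; apply: Ranti => //; exact: mmin.
Qed.

(** Transfinite recursion: at stage w only countably many points are used up, so
    the uncountable set [S w] still has infinitely many points to offer.
    Countably many points per index, and not just one, give an injection of
    W * nat, hence the cardinal arithmetic aleph_1 * aleph_0 = aleph_1; two
    points per index suffice for the Bernstein construction below. *)
Lemma disjoint_refinement (W : Type) (lt : W -> W -> Prop) (T : Type)
    (S : W -> set T) :
  omega1_order W lt -> (forall w, ~ countable (S w)) ->
  exists2 f : W * nat -> T, injective f & forall w n, S w (f (w, n)).
Proof.
move=> [ltwf lttri ltcount _] Sunc.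
pose good w (C : set T) (t : nat -> T) :=
  injective t /\ forall n, S w (t n) /\ ~ C (t n).
(* A countable set [C] of used points leaves a sequence of fresh ones. *)
have step (p : W * set T) : exists t, countable p.2 -> good p.1 p.2 t.
  case: p => w C /=; have [cC|] := pselect (countable C); last first.
    move=> nC; have [x _] : S w !=set0.
      by apply/set0P/eqP => S0; apply: (Sunc w); rewrite S0; exact: countable0.
    by exists (fun=> x).
  have /infiniteP : infinite_set (S w `\` C).
    apply: contra_not (Sunc w) => fin.
    have cU : countable (\bigcup_(b in [set: bool]) if b then C else S w `\` C).
      apply: bigcup_countable => [|[] _]; [exact: countableP|exact: cC|].
      exact: finite_set_countable.
    apply: sub_countable cU; apply: subset_card_le => x Sx.
    by have [Cx|nCx] := pselect (C x); [exists true | exists false].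
  elim/Ppointed: T => T in S Sunc good C cC *.
    by case: (Sunc w); rewrite emptyE; exact: countable0.
  move=> /pcard_leP/unsquash g; exists g => _; split.
    by move=> m n; apply: inj; rewrite inE.
  by move=> n; have [] : (S w `\` C) (g n) by exact: funS.
have [pick pickP] := choice step.
pose used w (f : forall v, lt v w -> nat -> T) :=
  [set x | exists v (h : lt v w) n, f v h n = x].
pose F w f := pick (w, used w f).
pose f := Fix ltwf (fun=> nat -> T) F.
have fE w : f w = F w (fun v _ => f v).
  rewrite /f Fix_eq // => x g h gh; congr F.
  by do 2!apply: functional_extensionality_dep => ?.
have fgood w : good w (used w (fun v _ => f v)) (f w).
  rewrite fE; apply: pickP => /=.
  have -> : used w (fun v _ => f v) =
      \bigcup_(v in [set v | lt v w]) (f v @` setT).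
    apply/seteqP; split=> [x [v [h [n <-]]]|x [v h [n _ <-]]].
      by exists v => //; exists n.
    by exists v, h, n.
  apply: bigcup_countable => // v _.
  by apply: sub_countable (card_image_le _ _) _; exact: countableP.
have fresh v w m n : lt v w -> f v m <> f w n.
  move=> vw E; have [_ /(_ n)[_]] := fgood w; apply.
  by exists v, vw, m.
exists (fun p => f p.1 p.2) => [[v m] [w n] /= E|w n /=]; last first.
  by have [_ /(_ n)[]] := fgood w.
have [h|h|h] := lttri v w; [by case: (fresh _ _ _ _ h E)| |].
  by subst w; have [inj _] := fgood v; rewrite (inj _ _ E).
by case: (fresh _ _ _ _ h (esym E)).
Qed.

(** With [g] the identity, this says that W * nat has cardinality aleph_1. *)
Lemma aleph1_range (W : Type) (lt : W -> W -> Prop) (T : Type) (g : W * nat -> T) :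
  omega1_order W lt -> ~ countable (range g) -> card_aleph1 (range g).
Proof.
move=> HW gunc; split=> // U B Bunc.
have [f finj fB] := @disjoint_refinement W lt U (fun=> B) HW (fun=> Bunc).
apply: card_le_trans (card_image_le _ _) _.
have finj' : set_inj [set: W * nat] f by move=> p q _ _; exact: finj.
have /card_eqPle[_ le] := inj_card_eq finj'.
apply: card_le_trans le (subset_card_le _).
by move=> _ [[w n] _ <-].
Qed.

(** * A set that is not coded *)

Lemma finite_nat_bounded (A : set nat) :
  finite_set A -> exists n, forall k, A k -> (k < n)%N.
Proof.
move=> /finite_seqP[s ->]; exists (\max_(i <- s) i).+1 => k /= ks.
by rewrite ltnS; exact: leq_bigmax_seq.
Qed.

(** From each uncountable [S w] two points are picked, all picked points being
    distinct; [Z] collects the second ones, and the first one witnesses that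
    [S w] is not included in [Z].  A countable [S w] is replaced by the whole
    of W, so that every index contributes and [Z] is uncountable. *)
Lemma bernstein (W : Type) (lt : W -> W -> Prop) (S : W -> set W) :
  omega1_order W lt ->
  exists2 Z : set W, ~ countable Z & forall w, S w `<=` Z -> countable (S w).
Proof.
move=> HW; have [_ _ _ Wunc] := HW.
pose S' w := if pselect (countable (S w)) then setT else S w.
have [|f finj fS] := @disjoint_refinement W lt W S' HW.
  by move=> w; rewrite /S'; case: pselect.
exists (range (fun w => f (w, 1))).
  apply: (@uncountable_image _ _ (fun w => f (w, 1)) setT _ _ _ Wunc).
    by move=> v w _ _ /finj[].
  exact: subset_refl.
move=> w SZ; apply: contrapT => unc.
have Sf : S w (f (w, 0)) by have := fS w 0; rewrite /S'; case: pselect.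
by have [v _ /finj] := SZ _ Sf.
Qed.

(** A set coded by [b] is a countable union of sets {v | a v \ c is finite},
    with c running through a countable cofinal part of the ideal, in a suitable
    subalgebra of size aleph_1, of sets below the complement of b.  An
    uncountable [Z] that includes only countable sets of this form is not such
    a union. *)
Lemma uncoded_set (W : Type) (lt : W -> W -> Prop) (a : W -> set nat) :
  aleph1_aleph0_ideal (set nat) -> omega1_order W lt ->
  exists Z : set W, forall b, Z <> [set w | finite_set (a w `&` b)].
Proof.
move=> [F [Fideal Fcofinal _]] HW; have [_ _ _ Wunc] := HW.
have [j jinj _] :=
  @disjoint_refinement W lt _ (fun=> setT) HW (fun=> uncountable_set_nat).
(* The value at 1 makes the range of [g] uncountable even if that of [a] is
   not; the initial segments turn almost inclusions of the sets [a v] into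
   inclusions of members of the subalgebra. *)
pose g (p : W * nat) : set nat := match p.2 with
  | 0 => a p.1 | 1 => j (p.1, 0) | n.+2 => `I_n end.
have galeph1 : card_aleph1 (range g).
  apply: aleph1_range HW _.
  apply: (@uncountable_image _ _ (fun w => j (w, 0)) setT _ _ _ Wunc).
    by move=> v w _ _ /jinj[].
  by move=> _ [w _ <-]; exists (w, 1).
have [A FA gA] := Fcofinal _ galeph1.
have [[[_ _ AI _ AC] Aideal] [Aunc Amin]] := Fideal _ FA.
have /pcard_surjP[e eA] : (A #<= [set: W])%card by exact: Amin.
have aA w : A (a w) by apply: gA; exists (w, 0).
have [w0 _] : [set: W] !=set0.
  by apply/set0P/eqP => W0; apply: Wunc; rewrite W0; exact: countable0.
have IA n : A `I_n by apply: gA; exists (w0, n.+2).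
have [Z Zunc ZS] := bernstein W lt (fun w => [set v | finite_set (a v `\` e w)]) HW.
exists Z => b Zb.
(* When the complement of [b] is itself in [A], it alone is cofinal; otherwise
   the strict inequality of the ideal condition agrees with inclusion. *)
have [C [cC CA Ccof]] : exists C : set (set nat), [/\ countable C,
    forall c, C c -> A c /\ c `<=` ~` b &
    forall x, A x -> x `<=` ~` b -> exists2 c, C c & x `<=` c].
  have [Ab|nAb] := pselect (A (~` b)).
    exists [set ~` b]; split; first exact: countable1.
      by move=> _ ->; split.
    by move=> x _ xb; exists (~` b).
  have [C [cC CA Ccof]] := Aideal _ nAb; exists C; split => //.
    by move=> c /CA[Ac]; rewrite properEset => -[].
  move=> x Ax xb; have [|c Cc] := Ccof x Ax; last by rewrite subsetEset; exists c.
  rewrite properEset; split => // bx; apply: nAb.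
  by have <- : x = ~` b by apply/seteqP.
apply: Zunc.
have -> : Z = \bigcup_(c in C) [set v | finite_set (a v `\` c)].
  apply/seteqP; split=> [v|v [c Cc] /= fin].
    rewrite {1}Zb => /= /finite_nat_bounded[n abn].
    have [||c Cc xc] := Ccof (a v `\` `I_n).
    - by rewrite setDE; apply: (AI _ _ (aA v)); exact: AC (IA n).
    - by move=> k [avk kn] bk; apply: kn; exact: abn.
    exists c => //=; apply: (@sub_finite_set _ _ `I_n); last exact: finite_II.
    by move=> k [avk nck]; apply: contrapT => kn; apply: nck; exact: xc.
  rewrite Zb /=; apply: sub_finite_set fin => k [avk bk]; split=> // ck.
  by have [_ /(_ _ ck)] := CA _ Cc.
apply: bigcup_countable => // c Cc; have [Ac cb] := CA _ Cc.
have [w _ ew] := eA _ Ac; rewrite -ew; apply: ZS => v /= fin.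
rewrite Zb /=; apply: sub_finite_set fin => k [avk bk]; split=> //.
by rewrite ew => /cb.
Qed.

(** * Clopen subsets of the remainder of beta N *)

Lemma Nstar_free (u : betaN) (n : nat) : Nstar u -> sets_of u (~` [set n]).
Proof.
move=> Nu; have uU := betaN_ultra u.
have [un|//] := in_ultra_setVsetC [set n] uU.
case: Nu; exists n => //; case: u uU un => u pu uU un.
(* Ultrafilters are maximal, so containing a principal one forces equality. *)
have E : u = principal_filter n.
  have pn := principal_filter_ultra n.
  apply: max_filter => A /principal_filterP An.
  by apply: filterS un => _ ->.
rewrite /nat_to_betaN; subst u; congr BetaN; exact: Prop_irrelevance.
Qed.

Lemma Nstar_infinite (u : betaN) (a : set nat) :
  Nstar u -> sets_of u a -> infinite_set a.
Proof.
move=> Nu ua /finite_nat_bounded[n an]; have uU := betaN_ultra u.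
have un : forall m, sets_of u (~` `I_m).
  elim=> [|m IH]; first by apply: filterS filterT => k _.
  apply: filterS (filterI IH (Nstar_free u m Nu)) => k [/= km nkm] kSm.
  by move: kSm; rewrite ltnS leq_eqVlt => /predU1P[/nkm|/km].
have [k [/an kn nkn]] := filter_ex (filterI ua (un n)).
exact: nkn.
Qed.

(** The sets [a] minus an initial segment of N generate a proper filter, and an
    ultrafilter extending it is free. *)
Lemma infinite_Nstar (a : set nat) :
  infinite_set a -> exists2 u, Nstar u & sets_of u a.
Proof.
move=> ainf.
have [|u [uU Fu]] := @ultraFilterLemma _ (filter_from setT (fun n => a `\` `I_n)).
  apply: filter_from_proper => [|n _].
    apply: filter_from_filter; first by exists 0.
    move=> m n _ _; exists (maxn m n) => // k [ak /negP].
    by rewrite -leqNgt geq_max => /andP[mk nk]; split; split=> //= ;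
      apply/negP; rewrite -leqNgt.
  apply/set0P/negP => /eqP/seteqP[an _]; apply: ainf.
  apply: (@sub_finite_set _ _ `I_n); last exact: finite_II.
  by move=> k ak; apply: contrapT => kn; apply: (an k).
exists (BetaN uU); last by apply: Fu; exists 0 => // k [].
move=> [n _ E]; have un : principal_filter n (a `\` `I_n.+1).
  have -> : principal_filter n = u by case: E.
  by apply: Fu; exists n.+1.
by have /principal_filterP[_ /=] := un; rewrite ltnSn.
Qed.

(** The ultrafilter extension theorem takes the place of a compactness argument
    for a locally constant P.  The sets a on which P holds throughout form an ideal, and so do those
    on which P fails throughout.  If no a is in the first with complement in
    the second, then no finite union of members of the two covers N, and some
    ultrafilter avoids both ideals; it is free since both contain the
    singletons, which contradicts local constancy at this ultrafilter. *)
Lemma Nstar_clopen (P : betaN -> Prop) :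
  (forall u, Nstar u -> exists2 a, sets_of u a &
     forall v, Nstar v -> sets_of v a -> P v <-> P u) ->
  exists a : set nat, forall u, Nstar u -> P u <-> sets_of u a.
Proof.
move=> Ploc.
pose below (Q : betaN -> Prop) (a : set nat) :=
  forall v, Nstar v -> sets_of v a -> Q v.
have belowU Q a b : below Q a -> below Q b -> below Q (a `|` b).
  move=> Qa Qb v Nv vab; have vU := betaN_ultra v.
  have [va|vna] := in_ultra_setVsetC a vU; first exact: Qa.
  by apply: Qb => //; apply: filterS (filterI vab vna) => k [[]].
have below1 Q n : below Q [set n].
  by move=> v Nv /(Nstar_infinite _ _ Nv) []; exact: finite_set1.
pose nP v := ~ P v.
have [[a [aP anP]]|none] :=
    pselect (exists a, below P a /\ below nP (~` a)).
  exists a => u Nu; have uU := betaN_ultra u; split=> [Pu|]; last exact: aP.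
  by have [//|/(anP _ Nu)] := in_ultra_setVsetC a uU.
exfalso.
have [|u [uU Fu]] := @ultraFilterLemma _ (filter_from
    [set p | below P p.1 /\ below nP p.2] (fun p => ~` (p.1 `|` p.2))).
  apply: filter_from_proper => [|[a b] /= [aP bP]].
    apply: filter_from_filter.
      by exists (set0, set0); split=> v _; have ? := betaN_ultra v;
        move=> /filter_not_empty.
    move=> [a b] [a' b'] /= [aP bP] [aP' bP'].
    exists (a `|` a', b `|` b'); first by split; exact: belowU.
    move=> k /= nk; split; apply: contra_not nk => -[];
      by [left; left|right; left|left; right|right; right].
  apply: contra_notP none => nab; exists a; split => // v Nv va.
  apply: bP => //; have ? := betaN_ultra v; apply: filterS va => k nak.
  by apply: contrapT => nbk; apply: nab; exists k => -[].
(* Either ideal contains the empty set, which serves as the other member. *)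
have nu a : below P a \/ below nP a -> ~ u a.
  move=> Qa ua.
  have : u (~` (a `|` set0)) \/ u (~` (set0 `|` a)).
    by case: Qa => Qa; [left|right]; apply: Fu;
      [exists (a, set0) => //|exists (set0, a) => //];
      split=> // v _; have ? := betaN_ultra v; move=> /filter_not_empty.
  by rewrite setU0 set0U; case=> una; have [k []] := filter_ex (filterI ua una).
have Nu : Nstar (BetaN uU).
  move=> [n _ [E]]; apply: (nu [set n]); first by left; exact: below1.
  by rewrite -E; exact/principal_filterP.
have [a ua aloc] := Ploc _ Nu; apply: (nu a) => //.
have [Pu|nPu] := pselect (P (BetaN uU)); [left|right] => v Nv va.
  by apply/(aloc v Nv va).
by move/(aloc v Nv va).
Qed.

Lemma betaN_nbhs (u : betaN) (B : set betaN) :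
  nbhs u B -> exists2 a, sets_of u a & betaN_base a `<=` B.
Proof.
rewrite nbhsE => -[U [[I _ <-] [a Ia ua]] UB].
by exists a => // v va; apply: UB; exists a.
Qed.

Lemma clopen_preimage (T : topologicalType) (f : betaN -> T) (Q : T -> Prop) :
  {within Nstar, continuous f} ->
  (forall t, nbhs t [set t' | Q t' <-> Q t]) ->
  exists a : set nat, forall u, Nstar u -> Q (f u) <-> sets_of u a.
Proof.
move=> /subspace_continuousP fcont Qloc.
apply: (Nstar_clopen (fun u => Q (f u))) => u Nu.
have [a ua aP] := betaN_nbhs _ _ (fcont u Nu _ (Qloc (f u))).
by exists a => // v Nv va; exact: aP.
Qed.

(** * The Alexandroff double and its square *)

(** If x is a cluster point of the projection of a filter F to the Cantor set,
    and (x,1) is not a cluster point of F, then (x,0) is: some member of F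
    omits (x,1), which is the only point separating neighbourhoods of (x,0)
    from preimages of neighbourhoods of x. *)
Lemma alexandroff_double_compact : compact [set: alexandroff_double].
Proof.
move=> F FF _.
pose G : set_system cantor_space := [set A | F (fst @^-1` A)].
have GF : ProperFilter G by exact: fmap_proper_filter.
have [x [_ clx]] := cantor_space_compact GF filterT.
have [cl1|ncl] := pselect (cluster F (x, true)); first by exists (x, true).
exists (x, false); split => // A U FA [V xV VU].
have [B [FB Bx]] : exists B, F B /\ ~ B (x, true).
  apply: contra_notP ncl => nB B C FB.
  move=> /principal_filterP Cx; exists (x, true); split => //.
  by apply: contrapT => nBx; apply: nB; exists B.
have GAB : G (fst @` (A `&` B)).
  rewrite /G /=; apply: (@filterS _ F _ (A `&` B)); last exact: filterI.
  by move=> p ABp; exists p.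
have [_ [[p [Ap Bp] <-] Vp]] := clx _ _ GAB xV.
exists p; split => //; apply: VU; split; first by split.
by move=> E; apply: Bx; rewrite -E.
Qed.

(** The singleton {(x,1)} is not only open but closed: it misses the
    neighbourhood of (x,0) obtained from the whole Cantor set. *)
Lemma isolated_clopen (x : cantor_space) (p : alexandroff_double) :
  nbhs p [set q | q = (x, true) <-> p = (x, true)].
Proof.
case: p => z [].
  exact/principal_filterP.
have [->|zx] := pselect (z = x).
  exists setT; first exact: filterT.
  by move=> q [_ /= qx]; split.
exists (~` [set x]).
  apply: open_nbhs_nbhs; split; last exact: zx.
  apply: closed_openC.
  exact/accessible_closed_set1/hausdorff_accessible/cantor_space_hausdorff.
by move=> q [[/= qx _] _]; split=> // E; case: qx; rewrite E.
Qed.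

Definition pruned_square (E : cantor_space -> cantor_space -> Prop) :
    set (alexandroff_double * alexandroff_double)%type :=
  [set p : alexandroff_double * alexandroff_double |
    p.1.2 -> p.2.2 -> E p.1.1 p.2.1].

(** Only isolated points of the square have been removed. *)
Lemma pruned_square_compact E : compact (pruned_square E).
Proof.
have KC := compact_setX alexandroff_double_compact alexandroff_double_compact.
apply: (subclosed_compact _ KC); last by [].
have -> : pruned_square E = ~` ~` pruned_square E by rewrite setCK.
apply: open_closedC; rewrite openE => -[[x b] [y c]] nE.
have [bT cT] : b /\ c.
  by split; apply: contrapT => h; apply: nE => /= bT cT; case: h.
exists ([set (x, b)], [set (y, c)]); last by move=> [p q] /= [-> ->].
by rewrite bT cT; split; exact/principal_filterP.
Qed.

(** * The diagonal argument *)

Theorem theorem3p9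
  (ideal_PN : aleph1_aleph0_ideal (set nat))
  (aleph1_c : two_pow_aleph1_eq_continuum) :
  exists X : set (alexandroff_double * alexandroff_double)%type,
    [/\ X !=set0, compact X & ~ continuous_image_of Nstar X].
Proof.
have [W [lt HW]] := omega1_exists; have [_ _ _ Wunc] := HW.
have [j jinj _] :=
  @disjoint_refinement W lt _ (fun=> setT) HW (fun=> uncountable_set_nat).
pose l w : cantor_space := fun k => `[< j (w, 0) k >].
have linj : injective l.
  move=> v w vw; suff /jinj[] : j (v, 0) = j (w, 0) by [].
  apply/funext => k; apply/propext.
  exact: asbool_eq_equiv (congr1 (fun h : cantor_space => h k) vw).
(* [s] enumerates all W-sequences of subsets of N, seen as subsets of W * nat. *)
have [s ssurj] : exists s : cantor_space -> W -> set nat,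
    forall a, exists y, s y = a.
  have WN : card_aleph1 [set: W * nat].
    rewrite -(image_id setT); apply: aleph1_range HW _.
    apply: (@uncountable_image _ _ (fun w => (w, 0)) setT _ _ _ Wunc) => //.
    by move=> v w _ _ [].
  have /card_eqPle[/pcard_surjP[g gsurj] _] := aleph1_c _ _ WN.
  exists (fun y w => [set n | g [set k | y k] (w, n)]) => a.
  have [B _ gB] := gsurj [set p | a p.1 p.2] (@subsetT _ _).
  exists (fun k => `[< B k >]); apply/funext => w.
  have -> : [set k | `[< B k >]] = B.
    by apply/seteqP; split=> k /asboolP.
  by rewrite gB.
have [Z ZP] := choice (fun a => uncoded_set W lt a ideal_PN HW).
pose E x y := exists2 w, x = l w & ~ Z (s y) w.
exists (pruned_square E); split.
- by exists ((point, false), (point, false)).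
- exact: pruned_square_compact.
move=> [f fcont fX].
have [a aP] := choice (fun w =>
  clopen_preimage _ f (fun p => p.1 = (l w, true)) fcont
    (fun p => cvg_fst (isolated_clopen (l w) p.1))).
have [y sy] := ssurj a.
have [b bP] := clopen_preimage _ f (fun p => p.2 = (y, true)) fcont
  (fun p => cvg_snd (isolated_clopen y p.2)).
apply: (ZP a b); apply/seteqP; split=> w /=.
  move=> Zw; apply: contrapT => /infinite_Nstar[u Nu uab].
  have uU := betaN_ultra u.
  have fu1 : (f u).1 = (l w, true).
    by apply/(aP w u Nu); apply: filterS uab => k [].
  have fu2 : (f u).2 = (y, true) by apply/(bP u Nu); apply: filterS uab => k [].
  have : pruned_square E (f u) by rewrite -fX; exists u.
  rewrite /pruned_square /= fu1 fu2 /= => /(_ isT isT)[w' /linj <-].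
  by rewrite sy.
move=> fin; apply: contrapT => nZw.
have : pruned_square E ((l w, true), (y, true)).
  by move=> _ _; exists w => //=; rewrite sy.
rewrite -fX => -[u Nu fu]; have uU := betaN_ultra u.
have : sets_of u (a w `&` b).
  by apply: filterI; [apply/(aP w u Nu)|apply/(bP u Nu)]; rewrite fu.
by move=> /(Nstar_infinite u _ Nu).
Qed.
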